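(* Let $M$ be a fixed binary matroid. Then there exist constants $k_M, L_M$ such that if $k \geq k_M$ (with $k$ fixed, independent of $n$) and $m \geq L_M n$, then with probability tending to $1$ as $n\to\infty$ the matroid $\mathcal{M}_{n,m,k}$ contains $M$ as a minor.
   Context: For positive integers $n,m,k$ with $k\le n$, let $\mathbf{A}_{n,m,k}$ be a random $n\times m$ matrix over $\mathbf{GF}_2$ whose columns are independent, each column having exactly $k$ ones in a set of $k$ rows chosen uniformly at random from the $\binom{n}{k}$ possible sets (and zeros elsewhere). Let $\mathcal{M}_{n,m,k}$ be the binary matroid on the set of columns of $\mathbf{A}_{n,m,k}$ whose independent sets are the sets of columns that are linearly independent over $\mathbf{GF}_2$. A matroid $M$ is a minor of a matroid $\mathcal{M}$ if it is isomorphic to a matroid obtained from $\mathcal{M}$ by a sequence of deletions and contractions, where for a matroid on ground set $E$ with independent sets $\mathcal{I}$, the deletion $\mathcal{M}\setminus X$ has ground set $E\setminus X$ and independent sets $\{I\in\mathcal{I}: I\subseteq E\setminus X\}$, and the contraction $\mathcal{M}/X$ (for $X\in\mathcal{I}$) has ground set $E\setminus X$ and independent sets $\{I\subseteq E\setminus X: I\cup X\in\mathcal{I}\}$. *)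

(* Defs.v *)
From HB Require Import structures.
From mathcomp Require Import all_boot all_order all_algebra.
From mathcomp Require Import boolp reals.

Set Implicit Arguments.
Unset Strict Implicit.
Unset Printing Implicit Defensive.

Import Order.TTheory GRing.Theory Num.Theory.

Local Open Scope ring_scope.

(* The ground set is a subset of the carrier type, so that deletions and
   contractions stay over the same type. *)
Record matroid (T : finType) := Matroid {
  ground : {set T};
  indep : {set {set T}};
  indep_sub : forall I : {set T}, I \in indep -> I \subset ground;
  indep0 : set0 \in indep;
  indep_hereditary :
    forall I J : {set T}, J \in indep -> I \subset J -> I \in indep;
  indep_augment :
    forall I J : {set T}, I \in indep -> J \in indep -> (#|I| < #|J|)%N ->
      exists2 x, x \in J :\: I & x |: I \in indep }.

Section Minors.
Variables (T : finType) (M : matroid T) (X : {set T}).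

Definition deletion_indep : {set {set T}} :=
  [set I in indep M | I \subset ground M :\: X].

Lemma deletion_sub (I : {set T}) :
  I \in deletion_indep -> I \subset ground M :\: X.
Proof. by rewrite inE => /andP[]. Qed.

Lemma deletion0 : set0 \in deletion_indep.
Proof. by rewrite inE indep0 sub0set. Qed.

Lemma deletion_hereditary (I J : {set T}) :
  J \in deletion_indep -> I \subset J -> I \in deletion_indep.
Proof.
rewrite !inE => /andP[iJ JE] IJ.
by rewrite (indep_hereditary iJ IJ) (subset_trans IJ JE).
Qed.

Lemma deletion_augment (I J : {set T}) :
  I \in deletion_indep -> J \in deletion_indep -> (#|I| < #|J|)%N ->
  exists2 x, x \in J :\: I & x |: I \in deletion_indep.
Proof.
rewrite ![_ \in deletion_indep]inE => /andP[iI IE] /andP[iJ JE] ltIJ.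
have [x xJI ixI] := indep_augment iI iJ ltIJ.
exists x => //; rewrite inE ixI subUset IE andbT sub1set.
by move: xJI; rewrite inE => /andP[_ /(subsetP JE)].
Qed.

Definition deletion : matroid T :=
  Matroid deletion_sub deletion0 deletion_hereditary deletion_augment.

Definition contraction_indep : {set {set T}} :=
  [set I : {set T} | (I \subset ground M :\: X) && (I :|: X \in indep M)].

Hypothesis indepX : X \in indep M.

Lemma contraction_sub (I : {set T}) :
  I \in contraction_indep -> I \subset ground M :\: X.
Proof. by rewrite inE => /andP[]. Qed.

Lemma contraction0 : set0 \in contraction_indep.
Proof. by rewrite inE sub0set set0U. Qed.

Lemma contraction_hereditary (I J : {set T}) :
  J \in contraction_indep -> I \subset J -> I \in contraction_indep.
Proof.
rewrite !inE => /andP[JE iJ] IJ.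
by rewrite (subset_trans IJ JE) (indep_hereditary iJ) ?setSU.
Qed.

Lemma contraction_augment (I J : {set T}) :
  I \in contraction_indep -> J \in contraction_indep -> (#|I| < #|J|)%N ->
  exists2 x, x \in J :\: I & x |: I \in contraction_indep.
Proof.
rewrite ![_ \in contraction_indep]inE => /andP[IE iI] /andP[JE iJ] ltIJ.
have card (K : {set T}) : K \subset ground M :\: X ->
    #|K :|: X| = (#|K| + #|X|)%N.
  rewrite subsetD => /andP[_ dKX].
  by rewrite cardsU (_ : K :&: X = set0) ?cards0 ?subn0 //; apply/eqP;
    rewrite setI_eq0.
have [|x xJI ixI] := indep_augment iI iJ; first by rewrite !card // ltn_add2r.
move: xJI; rewrite !inE negb_or => /andP[/andP[xI xX]].
rewrite (negPf xX) orbF => xJ; exists x; first by rewrite inE xI.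
rewrite inE -setUA ixI andbT subUset IE andbT sub1set.
exact: (subsetP JE).
Qed.

Definition contraction : matroid T :=
  Matroid contraction_sub contraction0 contraction_hereditary
    contraction_augment.

End Minors.

Inductive reduction (T : finType) (M : matroid T) : matroid T -> Prop :=
| ReductionRefl : reduction M M
| ReductionDelete (N : matroid T) (X : {set T}) :
    reduction M N -> X \subset ground N -> reduction M (deletion N X)
| ReductionContract (N : matroid T) (X : {set T}) (indepX : X \in indep N) :
    reduction M N -> reduction M (contraction indepX).

Definition isomorphic (T U : finType) (M : matroid T) (N : matroid U) : Prop :=
  exists2 f : {x : T | x \in ground M} -> {y : U | y \in ground N},
    bijective f &
    forall A : {set {x : T | x \in ground M}},
      ([set val x | x in A] \in indep M) =
      ([set val (f x) | x in A] \in indep N).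

Definition minor (T U : finType) (N : matroid T) (M : matroid U) : Prop :=
  exists2 M' : matroid U, reduction M M' & isomorphic N M'.

Section ColumnMatroid.
Variables (F : fieldType) (n m : nat) (A : 'M[F]_(n, m)).

Definition columns (I : {set 'I_m}) : seq 'cV[F]_n := [seq col j A | j in I].

(* Elements are column indices: equal columns in different positions are
   distinct (parallel) elements, and [free] takes repetitions into account. *)
Definition column_indep : {set {set 'I_m}} :=
  [set I : {set 'I_m} | free (columns I)].

Lemma column_sub (I : {set 'I_m}) : I \in column_indep -> I \subset [set: 'I_m].
Proof. by rewrite subsetT. Qed.

Lemma column_indep0 : set0 \in column_indep.
Proof. by rewrite inE /columns /image_mem enum_set0 nil_free. Qed.

Lemma column_hereditary (I J : {set 'I_m}) :
  J \in column_indep -> I \subset J -> I \in column_indep.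
Proof.
rewrite !inE => fJ IJ.
have e : perm_eq (enum J) (enum I ++ enum (J :\: I)).
  apply: uniq_perm; rewrite ?cat_uniq ?enum_uniq //=.
    by rewrite andbT; apply/hasPn => x; rewrite !mem_enum inE => /andP[].
  move=> x; rewrite mem_cat !mem_enum inE.
  by have [/(subsetP IJ)|] := boolP (x \in I).
by move: fJ; rewrite (perm_free (perm_map _ e)) map_cat => /catl_free.
Qed.

Lemma column_augment (I J : {set 'I_m}) :
  I \in column_indep -> J \in column_indep -> (#|I| < #|J|)%N ->
  exists2 x, x \in J :\: I & x |: I \in column_indep.
Proof.
rewrite ![_ \in column_indep]inE => fI fJ ltIJ.
have [sJI|] := boolP (all (fun v => v \in <<columns I>>%VS) (columns J)).
  have /dimvS : (<<columns J>> <= <<columns I>>)%VS.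
    by apply/span_subvP => v /(allP sJI).
  by rewrite (eqP fI) (eqP fJ) !size_image leqNgt ltIJ.
case/allPn => v /imageP[x xJ ->] xI.
have nxI : x \notin I by apply: contra xI => xI; rewrite memv_span ?image_f.
exists x; first by rewrite inE nxI.
have e : perm_eq (enum (x |: I)) (x :: enum I).
  apply: uniq_perm; rewrite /= ?mem_enum ?nxI ?enum_uniq // => y.
  by rewrite inE !mem_enum !inE.
by rewrite inE (perm_free (perm_map _ e)) /= free_cons xI.
Qed.

Definition column_matroid : matroid 'I_m :=
  Matroid column_sub column_indep0 column_hereditary column_augment.

End ColumnMatroid.

Definition binary (T : finType) (M : matroid T) : Prop :=
  exists (n m : nat) (A : 'M['F_2]_(n, m)), isomorphic M (column_matroid A).

Section RandomMatrix.
Variables (R : realType) (n m k : nat).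

Definition column_law (c : 'cV['F_2]_n) : R :=
  if #|[set i | c i 0 == 1]| == k then ('C(n, k)%:R)^-1 else 0.

(* The columns are independent, so the joint law is the product law. *)
Definition matrix_law (A : 'M['F_2]_(n, m)) : R :=
  \prod_(j < m) column_law (col j A).

Definition matrix_prob (E : 'M['F_2]_(n, m) -> Prop) : R :=
  \sum_(A | `[< E A >]) matrix_law A.

Lemma column_law_total : (k <= n)%N -> \sum_c column_law c = 1.
Proof.
move=> lekn; rewrite -big_mkcond sumr_const /=.
pose f (c : 'cV['F_2]_n) := [set i | c i 0 == 1].
have f_inj : injective f.
  move=> c d /setP e; apply/colP => i; move: (e i); rewrite !inE.
  by case: (c i 0) (d i 0) => [[|[|?]] ?] [[|[|?]] ?] //= _; apply: val_inj.
have -> : #|[pred c | #|f c| == k]| = 'C(n, k).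
  rewrite -[n in RHS]card_ord -card_draws -(card_imset _ f_inj).
  apply: eq_card => S; rewrite !inE; apply/imsetP/idP => [[c cP ->] //|SP].
  exists (\col_i (i \in S)%:R); rewrite ?inE.
    rewrite (_ : f _ = S) //; apply/setP => i.
    by rewrite inE mxE; case: (i \in S).
  by apply/setP => i; rewrite inE mxE; case: (i \in S).
by rewrite -[LHS]mulr_natr mulVf // pnatr_eq0 -lt0n bin_gt0.
Qed.

Lemma matrix_law_total : (k <= n)%N -> matrix_prob (fun _ => True) = 1.
Proof.
move=> lekn; rewrite /matrix_prob.
rewrite (eq_bigl xpredT); last by move=> A; apply/asboolP.
transitivity (\sum_(f : {ffun 'I_m -> 'cV['F_2]_n}) \prod_j column_law (f j)).
  pose h (f : {ffun 'I_m -> 'cV['F_2]_n}) := \matrix_(i, j) f j i 0.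
  rewrite (reindex h) /=.
    apply: eq_bigr => f _; apply: eq_bigr => j _; congr column_law.
    by apply/colP => i; rewrite !mxE.
  exists (fun A => [ffun j => col j A]) => [f _|A _].
    by apply/ffunP => j; rewrite ffunE; apply/colP => i; rewrite !mxE.
  by apply/matrixP => i j; rewrite mxE ffunE mxE.
rewrite -(bigA_distr_bigA (fun (j : 'I_m) c => column_law c)).
by rewrite big1 // => j _; exact: column_law_total.
Qed.

End RandomMatrix.

(* Main.v *)
(* Let P be the space F_2^p in which M is represented. A balanced labelling of
   the n rows by P extends to a linear map W from columns to P, and we contract
   the columns of ker W among the first (L - q) n. Let V be their span. A new
   column in ker W \ V raises dim V, which can happen at most n times; so, with
   probability tending to 1, the columns in ker W \ V end up having measure at
   most delta, where delta depends on p only.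
   Write a random column as e_a + e_b + r, with r of weight k - 2 > 0. Most of
   the triples (a, b, r) with W (e_a + e_b + r) = 0 have e_a + e_b + r in V.
   Hence, modulo V, both e_a + e_b and r are mostly functions of their image
   under W, and these functions agree with a single additive section rho of W.
   So a further column y satisfies W y = v and y = rho v modulo V with
   probability bounded below, for each v in P: the last q n columns contain
   representatives of all the elements of M. *)

Require Import Defs.
From HB Require Import structures.
From mathcomp Require Import all_boot all_order all_algebra.
From mathcomp Require Import reals.
From mathcomp Require Import zify ring lra.
Import Order.TTheory GRing.Theory Num.Theory.

Set Implicit Arguments.
Unset Strict Implicit.
Unset Printing Implicit Defensive.

Local Open Scope ring_scope.

(** * Approximate homomorphisms in exponent two *)

(** A triple of total label 0 that is not bad says [f a + f b = g r], so both sides mostly depend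
    only on the common label. A typical value of [g] over each label defines [rho], and cancelling
    [f b] in [(f a + f b) + (f b + f c)] makes it additive. [E] records that every fibre of [w] and
    of [w'] has density at least [1 / E]. *)
Lemma approx_hom (I D : finType) (P : finZmodType) (G : zmodType)
    (f : I -> G) (g : D -> G) (w : I -> P) (w' : D -> P) (E : nat) :
  (forall x : P, x + x = 0) -> (forall x : G, x + x = 0) ->
  (0 < #|I|)%N -> (0 < #|D|)%N ->
  (forall v, #|I| <= E * \sum_a (w a == v))%N ->
  (forall v, #|D| <= E * \sum_r (w' r == v))%N ->
  (8 * E ^ 4 * (\sum_a \sum_b \sum_r
     ((w a + w b + w' r == 0)%R && (f a + f b + g r != 0)%R))
   <= #|I| * #|I| * #|D|)%N ->
  exists rho : P -> G, {morph rho : u v / u + v} /\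
    forall v, (#|I| * #|I| * #|D| <= 2 * E * \sum_a \sum_b \sum_r
      ((w a + w b + w' r == v)%R && (f a + f b + g r == rho v)%R))%N.
Proof.
move=> P2 G2 I0 D0 hw hw' hbad.
have PN (x : P) : - x = x by apply/eqP; rewrite -subr_eq0 -opprD P2 oppr0.
have GN (x : G) : - x = x by apply/eqP; rewrite -subr_eq0 -opprD G2 oppr0.
set N := #|I| in I0 hw hbad *; set Dn := #|D| in D0 hw' hbad *.
set Bad := (\sum_a _)%N in hbad.
pose beta u r : nat :=
  (\sum_a \sum_b ((w a + w b == u)%R && (f a + f b != g r)%R))%N.
(* [rho u] is the value of [g] at an element [rr u] of the fibre of [w'] above
   [u] that lies in a minimal number of bad triples. *)
have /fin_all_exists[rr hrr] u :
    exists r, (Dn * beta u r <= E * \sum_(r' | w' r' == u) beta u r')%N.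
  have [r0 wr0] : exists r, w' r == u.
    apply/existsP; apply: contraLR D0 => /existsPn h.
    by rewrite -leqNgt (leq_trans (hw' u)) // big1 ?muln0 // => r _; rewrite (negPf (h r)).
  case: (@arg_minnP _ r0 (fun r => w' r == u) (beta u) wr0) => r wr hr; exists r.
  apply: (@leq_trans ((E * \sum_r' (w' r' == u)) * beta u r)%N).
    by rewrite leq_mul2r hw' orbT.
  rewrite -mulnA leq_mul2l big_distrl /= [leqRHS]big_mkcond leq_sum ?orbT // => r' _.
  by case: ifP => [/hr|]; rewrite ?mul1n.
pose rho u := g (rr u).
pose B a b : bool := f a + f b != rho (w a + w b).
pose B2 := (\sum_a \sum_b B a b)%N.
(* Sum the choice of [rr u] over all labels: the left sides count the pairs that violate [rho], the
   right sides the bad triples. *)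
have hB2 : (Dn * B2 <= E * Bad)%N.
  have -> : B2 = (\sum_u beta u (rr u))%N.
    rewrite /beta exchange_big /=; apply: eq_bigr => a _.
    rewrite exchange_big /=; apply: eq_bigr => b _.
    rewrite (bigD1 (w a + w b)) //= eqxx /= big1 ?addn0 // => u.
    by rewrite eq_sym => /negPf->.
  have -> : Bad = (\sum_u \sum_(r | w' r == u) beta u r)%N.
    rewrite /Bad; under eq_bigr => a _ do rewrite exchange_big /=.
    rewrite exchange_big /= (partition_big w' predT) //=.
    apply: eq_bigr => u _; apply: eq_bigr => r /eqP <-.
    apply: eq_bigr => a _; apply: eq_bigr => b _.
    by rewrite !addr_eq0 PN GN.
  by rewrite !big_distrr /= leq_sum.
(* Some (a, b, c) above (u, v, t) has all its three pairs good. *)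
have rho_tri u v t : rho (u + v) + rho (v + t) = rho (u + t).
  apply/eqP/negPn/negP => ne.
  have : (N * N * N <= E ^ 3 * (3 * N * B2))%N.
    have h : ((\sum_a (w a == u)) * (\sum_b (w b == v)) * (\sum_c (w c == t)) <= 3 * N * B2)%N.
      apply: (@leq_trans (\sum_a \sum_b \sum_c (B a b + B b c + B a c))%N).
        rewrite !big_distrl /=; apply: leq_sum => a _.
        rewrite [X in (X * _)%N]big_distrr big_distrl /=; apply: leq_sum => b _.
        rewrite big_distrr /=; apply: leq_sum => c _.
        have [wa|] := eqVneq (w a) u; last by rewrite !mul0n.
        have [wb|] := eqVneq (w b) v; last by rewrite muln0.
        have [wc|] := eqVneq (w c) t; last by rewrite muln0.
        rewrite /B wa wb wc; move: ne.
        have [<-|] //= := eqVneq (f a + f b) _.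
        have [<-|] //= := eqVneq (f b + f c) _.
        have [<-|] //= := eqVneq (f a + f c) _.
        by rewrite addrA -[f a + f b + f b]addrA G2 addr0 eqxx.
      under eq_bigr => a _ do under eq_bigr => b _ do rewrite !big_split /= sum_nat_const.
      under eq_bigr => a _ do rewrite !big_split /= -big_distrr /= [X in (_ + X)%N]sum_nat_const.
      rewrite !big_split /= sum_nat_const -!big_distrr /= -/B2 -/N; lia.
    have := leq_mul (leq_mul (hw u) (hw v)) (hw t) => h2.
    apply: (leq_trans h2); apply: leq_trans (leq_mul (leqnn (E ^ 3)%N) h).
    by apply/eq_leq; lia.
  have -> : (N * N * N = N * (N * N))%N by lia.
  have -> : (E ^ 3 * (3 * N * B2) = N * (3 * E ^ 3 * B2))%N by lia.
  rewrite leq_pmul2l // => h.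
  (* These bounds chain to [N * N * Dn <= 3 * E ^ 4 * Bad], against
     [8 * E ^ 4 * Bad <= N * N * Dn]. *)
  have h1 : (N * N * Dn <= 3 * E ^ 3 * (Dn * B2))%N.
    by rewrite mulnCA [leqLHS]mulnC leq_mul2l h orbT.
  have h2 : (3 * E ^ 3 * (Dn * B2) <= 3 * E ^ 3 * (E * Bad))%N by rewrite leq_mul2l hB2 orbT.
  have e : (E ^ 4 = E ^ 3 * E)%N by rewrite -expnSr.
  have : (0 < N * N * Dn)%N by rewrite !muln_gt0 I0 D0.
  move: hbad h1 h2; rewrite e; nia.
have rhoD : {morph rho : u v / u + v}.
  by move=> u v; rewrite -(rho_tri u 0 v) addr0 add0r.
exists rho; split => // v.
set Good := (\sum_a _)%N.
have pairs u : (N * N <= E * \sum_a \sum_b (w a + w b == u)%R)%N.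
  rewrite {1}/N -sum_nat_const big_distrr /=; apply: leq_sum => a _.
  apply: leq_trans (hw (u - w a)) _; rewrite leq_mul2l leq_sum ?orbT // => b _.
  by rewrite -subr_eq opprK addrC.
have tot : (N * N * Dn <= E * \sum_a \sum_b \sum_r (w a + w b + w' r == v)%R)%N.
  rewrite -mulnA {1}/N -sum_nat_const big_distrr /=; apply: leq_sum => a _.
  rewrite {1}/N -sum_nat_const big_distrr /=; apply: leq_sum => b _.
  apply: leq_trans (hw' (v - (w a + w b))) _; rewrite leq_mul2l leq_sum ?orbT // => r _.
  by rewrite -subr_eq opprK addrC.
pose Rb := (\sum_r (g r != rho (w' r)))%N.
(* If [g r] differs from [rho (w' r)], each of the at least [N * N / E] pairs with label [w' r]
   violates [rho] or forms a bad triple with [r]. *)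
have hRb : (N * N * Rb <= E * (Dn * B2 + Bad))%N.
  rewrite /Rb big_distrr /=.
  apply: (@leq_trans (\sum_r \sum_a \sum_b E * (B a b +
    ((w a + w b + w' r == 0) && (f a + f b + g r != 0))%R))%N).
    apply: leq_sum => r _; have [_|ne] := eqVneq; first by rewrite muln0.
    rewrite muln1; apply: leq_trans (pairs (w' r)) _.
    rewrite big_distrr /=; apply: leq_sum => a _.
    rewrite big_distrr /=; apply: leq_sum => b _; rewrite leq_mul2l; apply/orP; right.
    rewrite !addr_eq0 PN GN /B; have [->|//] := eqVneq (w a + w b).
    by have [->|] := eqVneq (f a + f b) (g r); rewrite ?ne // addn1.
  under eq_bigr => r _ do under eq_bigr => a _ do rewrite -big_distrr big_split /=.
  under eq_bigr => r _ do rewrite -big_distrr big_split /=.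
  rewrite -big_distrr big_split /= sum_nat_const -/B2 -/Dn.
  rewrite leq_mul2l leq_add2l; apply/orP; right.
  rewrite exchange_big /=; apply: leq_sum => a _.
  by rewrite exchange_big /=.
have hG : (N * N * Dn <= E * (Good + Dn * B2 + N * N * Rb))%N.
  apply: (leq_trans tot); rewrite leq_mul2l; apply/orP; right.
  apply: (@leq_trans (\sum_a \sum_b \sum_r
    (((w a + w b + w' r == v) && (f a + f b + g r == rho v))%R
     + B a b + (g r != rho (w' r))))%N).
    apply: leq_sum => a _; apply: leq_sum => b _; apply: leq_sum => r _.
    have [<-|//] := eqVneq (w a + w b + w' r); rewrite /B !rhoD.
    have [->|] := eqVneq (f a + f b); last by move=> _; case: (_ && _); case: (g r != _).
    by have [->|] := eqVneq (g r); rewrite ?eqxx ?addn1.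
  under eq_bigr => a _ do under eq_bigr => b _ do rewrite !big_split /= sum_nat_const.
  under eq_bigr => a _ do rewrite !big_split /= -big_distrr /= [X in (_ + X)%N]sum_nat_const.
  by rewrite !big_split /= -big_distrr /= [X in (_ + X)%N]sum_nat_const mulnA.
have E0 : (0 < E)%N by rewrite lt0n; apply/eqP => e; move: (hw 0); rewrite e mul0n leqNgt I0.
(* The losses in [hG] total at most [3 * E ^ 4 * Bad], three eighths of all triples; the remaining
   five eighths exceed the half that the factor 2 asks for. *)
have -> : (2 * E * Good = 2 * (E * Good))%N by lia.
have h1 : (E * (Dn * B2) <= E * (E * Bad))%N by rewrite leq_mul2l hB2 orbT.
have h2 : (E * (N * N * Rb) <= E * (E * (Dn * B2 + Bad)))%N by rewrite leq_mul2l hRb orbT.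
have h3 : (E * (E * (Dn * B2)) <= E * (E * (E * Bad)))%N by rewrite leq_mul2l h1 orbT.
have h4 : (E * (E * Bad) <= E ^ 4 * Bad)%N.
  by rewrite mulnA leq_mul2r -[X in (X <= _)%N]/(E ^ 2)%N leq_pexp2l ?orbT.
have h5 : (E * (E * (E * Bad)) <= E ^ 4 * Bad)%N.
  by rewrite !mulnA leq_mul2r -mulnA -[X in (X <= _)%N]/(E ^ 3)%N leq_pexp2l ?orbT.
rewrite !mulnDr in h2 hG.
move: hG hbad; rewrite -mulnA; lia.
Qed.

(** * Minors of column matroids *)

(** Coefficients on all indices, null outside [I], can be moved between matrices without the
    enumeration hidden in [free]. *)
Lemma column_indepP (F : fieldType) (n m : nat) (A : 'M[F]_(n, m))
    (I : {set 'I_m}) :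
  reflect (forall c : 'I_m -> F, (forall i, i \notin I -> c i = 0) ->
             \sum_i c i *: col i A = 0 -> forall i, c i = 0)
          (I \in column_indep A).
Proof.
have nthE (i : 'I_#|I|) : (columns A I)`_i = col (enum_val i) A.
  have x0 : 'I_m := enum_val i.
  by rewrite /columns /image_mem (enum_val_nth x0) (nth_map x0) -?cardE.
rewrite inE; have sz : size (columns A I) == #|I| by rewrite size_image.
apply: (iffP (@freeP _ _ _ (Tuple sz))) => /= h.
  move=> c c0 cA i; have [iI|/c0 //] := boolP (i \in I).
  rewrite -(enum_rankK_in iI iI); apply: (h (fun j => c (enum_val j))).
  rewrite -[RHS]cA [RHS](bigID (mem I)) /= [X in _ = _ + X]big1 => [|j /c0->].
    2: by rewrite scale0r.
  by rewrite addr0 [RHS]big_enum_val /=; apply: eq_bigr => j _; rewrite nthE.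
move=> k kA i.
(* Extension of [k] by zero: the sum has one term if [j] is in [I] and none otherwise. *)
have := h (fun j => \sum_(l < #|I| | enum_val l == j) k l) _ _ (enum_val i).
rewrite (big_pred1 i) /=; last by move=> l; rewrite (inj_eq enum_val_inj).
apply=> [j jI|].
  by rewrite big_pred0 // => l; apply: contraNF jI => /eqP <-; apply: enum_valP.
rewrite -[RHS]kA [RHS](partition_big (fun l : 'I_#|I| => enum_val l) predT) //=.
apply: eq_bigr => j _; rewrite scaler_suml; apply: eq_bigr => l /eqP <-.
by rewrite nthE.
Qed.

Arguments column_indepP {F n m A I}.

(** Contraction requires an independent set; a maximal independent part of [X0] has the same
    span. *)
Lemma column_basis (F : fieldType) (n m : nat) (A : 'M[F]_(n, m))
    (X0 : {set 'I_m}) :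
  exists X : {set 'I_m}, [/\ X \subset X0, X \in column_indep A &
    (<<columns A X0>> <= <<columns A X>>)%VS].
Proof.
have [|X] := @ex_maxset _ (fun Y : {set 'I_m} => (Y \subset X0) && (Y \in column_indep A)).
  by exists set0; rewrite sub0set column_indep0.
case/maxsetP => /andP[sX iX] maxX; exists X; split => //.
apply/span_subvP => v /imageP[j jX0 ->].
have [jX|jX] := boolP (j \in X); first by rewrite memv_span ?image_f.
apply/negPn/negP => nj.
have := maxX (j |: X); rewrite subUset sub1set jX0 sX /= subsetUr => h.
have e : perm_eq (enum (j |: X)) (j :: enum X).
  apply: uniq_perm; rewrite /= ?mem_enum ?jX ?enum_uniq // => y.
  by rewrite inE !mem_enum !inE.
move: (iX); rewrite !inE => fX.
have : j |: X \in column_indep A.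
  by rewrite inE (perm_free (perm_map _ e)) /= free_cons nj.
by move=> /h /(_ isT) e'; move: jX; rewrite -e' setU11.
Qed.

Lemma span_columnsP (F : fieldType) (n m : nat) (A : 'M[F]_(n, m))
    (X : {set 'I_m}) (u : 'cV[F]_n) :
  u \in <<columns A X>>%VS ->
  exists2 c : 'I_m -> F, (forall i, i \notin X -> c i = 0) & u = \sum_i c i *: col i A.
Proof.
have sz : size (columns A X) == #|X| by rewrite size_image.
move=> /(@coord_span _ _ _ (Tuple sz)) /= uE; pose k i := coord (Tuple sz) i u.
exists (fun j => \sum_(l < #|X| | enum_val l == j) k l) => [j jX|].
  by rewrite big_pred0 // => l; apply: contraNF jX => /eqP <-; apply: enum_valP.
rewrite uE (partition_big (fun l : 'I_#|X| => enum_val l) predT) //=.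
apply: eq_bigr => j _; rewrite scaler_suml; apply: eq_bigr => l /eqP <-.
have x0 : 'I_m := enum_val l.
by rewrite /columns /image_mem (enum_val_nth x0) (nth_map x0) -?cardE.
Qed.

(* The columns in [ker W] are contracted, after which the [y j] represent the
   same matroid as the columns of [B]. *)
Lemma column_minor (F : fieldType) (n m p q : nat) (A : 'M[F]_(n, m))
    (B : 'M[F]_(p, q)) (W : {linear 'cV[F]_n -> 'cV[F]_p})
    (X0 : {set 'I_m}) (y : 'I_q -> 'I_m) :
  injective y -> (forall j, y j \notin X0) ->
  (forall i, i \in X0 -> W (col i A) = 0) ->
  (forall j, W (col (y j) A) = col j B) ->
  (forall d : 'I_q -> F, \sum_j d j *: col j B = 0 ->
     \sum_j d j *: col (y j) A \in <<columns A X0>>%VS) ->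
  minor (column_matroid B) (column_matroid A).
Proof.
move=> y_inj yX0 WX0 Wy dep.
have [X [sX iX spX]] := column_basis A X0.
pose Y := [set y j | j : 'I_q].
have yX j : y j \notin X by apply: contra (yX0 j); apply: (subsetP sX).
pose N := @contraction _ (column_matroid A) X iX.
have gN : ground N = ~: X by rewrite /= setTD.
have YgN : Y \subset ground N.
  by rewrite gN; apply/subsetP => _ /imsetP[j _ ->]; rewrite inE yX.
pose N' := deletion N (~: X :\: Y).
have gN' : ground N' = Y.
  rewrite /= setTD; apply/setP => i; rewrite !inE.
  have [/(subsetP YgN)|] := boolP (i \in Y); first by rewrite gN inE => ->.
  by case: (i \in X).
have yN' j : y j \in ground N' by rewrite gN' imset_f.
exists N'.
  apply: ReductionDelete; last by rewrite gN subDset subsetUr.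
  by apply: ReductionContract; apply: ReductionRefl.
have indepE (J : {set 'I_q}) :
    (J \in column_indep B) = ([set y j | j in J] \in indep N').
  have sJ : [set y j | j in J] \subset Y by apply/subsetP => _ /imsetP[j _ ->]; apply: imset_f.
  have inN' (K : {set 'I_m}) : K \subset Y -> (K \in indep N') = (K :|: X \in column_indep A).
    move=> sK; transitivity ((K \in indep N) && (K \subset ground N')); first by rewrite inE.
    by rewrite gN' sK andbT inE (subset_trans sK YgN).
  rewrite inN' //; apply/idP/idP => [iB|iA].
    apply/column_indepP => c c0 cA.
    (* [W] kills the columns in [X] and turns the relation into one among columns of [B], so the
       coefficients on [Y] vanish and a relation within [X] remains. *)
    have c_y : forall j, c (y j) = 0.
      move=> j0; have hB := elimT column_indepP iB; apply: (hB (fun j => c (y j))) => [j jJ|].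
        by apply: c0; rewrite inE negb_or yX andbT (mem_imset _ _ y_inj).
      transitivity (W (\sum_i c i *: col i A)); last by rewrite cA linear0.
      rewrite linear_sum [RHS](bigID (mem Y)) /= [X in _ = _ + X]big1 => [|i iY].
        rewrite addr0 big_imset /= => [|? ? _ _]; last exact: y_inj.
        by apply: eq_bigr => j _; rewrite linearZ /= Wy.
      rewrite linearZ /=; have [iX'|iX'] := boolP (i \in X).
        by rewrite WX0 ?scaler0 ?(subsetP sX).
      by rewrite c0 ?scale0r // inE negb_or iX' andbT; apply: contra iY; apply: (subsetP sJ).
    have hX := elimT column_indepP iX; apply: (hX c) => // i iX'.
    have [/imsetP[j _ ->] //|iY] := boolP (i \in Y).
    by apply: c0; rewrite inE negb_or iX' andbT; apply: contra iY; apply: (subsetP sJ).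
  apply/column_indepP => d d0 dB j0.
  (* A relation [d] of [B] lifts to a vector in the span of [X]; subtracting its expansion [e] gives
     a relation among the columns of [A]. *)
  have /span_columnsP[e e0 eE] := subvP spX _ (dep d dB).
  pose c i := \sum_(j | y j == i) d j - e i.
  have c_y j : c (y j) = d j.
    by rewrite /c (big_pred1 j) /= => [|l]; rewrite ?(inj_eq y_inj) // e0 ?subr0.
  rewrite -c_y; have hA := elimT column_indepP iA; apply: (hA c) => [i|].
    rewrite inE negb_or => /andP[iJ iX']; rewrite /c e0 // subr0 big1 // => j /eqP ji.
    by apply: d0; apply: contra iJ => jJ; rewrite -ji imset_f.
  rewrite (eq_bigr (fun i => (\sum_(j | y j == i) d j) *: col i A - e i *: col i A)) => [|i _].
    rewrite sumrB -eE (partition_big y predT) //= -sumrB big1 // => i _.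
    by rewrite scaler_suml -sumrB big1 // => j /eqP ->; rewrite subrr.
  by rewrite scalerBl.
pose f (x : {x : 'I_q | x \in ground (column_matroid B)}) :
  {z : 'I_m | z \in ground N'} := exist _ (y (val x)) (yN' _).
exists f => [|J].
  have q0 j : j \in ground (column_matroid B) by rewrite inE.
  have yP (z : {z : 'I_m | z \in ground N'}) : exists j, y j == val z.
    have : val z \in Y by rewrite -gN' (valP z).
    by case/imsetP => j _ ->; exists j.
  exists (fun z => exist _ (xchoose (yP z)) (q0 _)) => [x|z]; apply: val_inj => /=.
    by apply: y_inj; apply/eqP/(xchooseP (yP (f x))).
  exact/eqP/(xchooseP (yP z)).
by rewrite [LHS]indepE -!imset_comp.
Qed.

(** * Independent columns drawn one at a time *)

Section SeqExpectation.
Variables (R : realFieldType) (C : finType) (mu : C -> R).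
Hypotheses (mu_ge0 : forall c, 0 <= mu c) (mu_total : \sum_c mu c = 1).

(** Expectation of [F] over [m] independent draws from [mu], computed by conditioning on the first
    draw. *)
Fixpoint seqE (m : nat) (F : seq C -> R) : R :=
  if m is m'.+1 then \sum_c mu c * seqE m' (fun s => F (c :: s)) else F [::].

Lemma seqE_le m (F G : seq C -> R) :
  (forall s, size s = m -> F s <= G s) -> seqE m F <= seqE m G.
Proof.
elim: m F G => [|m IH] F G le_FG /=; first exact: le_FG.
apply: ler_sum => c _; apply: ler_wpM2l => //; apply: IH => s sz.
by apply: le_FG; rewrite /= sz.
Qed.

Lemma seqE_const m x : seqE m (fun=> x) = x.
Proof. by elim: m => //= m ->; rewrite -mulr_suml mu_total mul1r. Qed.

Lemma seqE_add m (F G : seq C -> R) :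
  seqE m (fun s => F s + G s) = seqE m F + seqE m G.
Proof.
elim: m F G => [|m IH] F G //=; rewrite -big_split /=.
by apply: eq_bigr => c _; rewrite IH mulrDr.
Qed.

Lemma seqE_cat m1 m2 (F : seq C -> R) :
  seqE (m1 + m2) F = seqE m1 (fun s => seqE m2 (fun t => F (s ++ t))).
Proof. by elim: m1 F => [|m IH] F //=; apply: eq_bigr => c _; rewrite IH. Qed.

Lemma seqE_ge0 m (F : seq C -> R) : (forall s, 0 <= F s) -> 0 <= seqE m F.
Proof. by move=> F0; rewrite -(seqE_const m 0); apply: seqE_le. Qed.

Lemma sum_compl (G : pred C) :
  \sum_(x | ~~ G x) mu x = 1 - \sum_(x | G x) mu x.
Proof. by rewrite -mu_total [X in _ = X - _](bigID G) /= [RHS]addrC addKr. Qed.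

Lemma seqE_hasN m (G : pred C) (c : R) : c <= \sum_(x | G x) mu x ->
  seqE m (fun s => (~~ has G s)%:R) <= (1 - c) ^+ m.
Proof.
move=> cG; elim: m => [|m IH] //=; rewrite (bigID G) /= big1 => [|x Gx].
  rewrite add0r (eq_bigr (fun x => mu x * seqE m (fun s => (~~ has G s)%:R))) => [|x /negPf nG].
    rewrite -mulr_suml exprS ler_pM ?sumr_ge0 ?seqE_ge0 //.
    by rewrite sum_compl lerD2l lerN2.
  by rewrite nG.
by rewrite Gx seqE_const mulr0.
Qed.

(** Each predicate is sought in its own block of [b] draws; disjoint blocks yield distinct columns
    even when predicates coincide. *)
Fixpoint hits (b : nat) (Gs : seq (pred C)) (s : seq C) : bool :=
  if Gs is G :: Gs' then has G (take b s) && hits b Gs' (drop b s) else true.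

(** A union bound over the blocks: each misses its predicate with probability at most
    [(1 - c) ^+ b]. *)
Lemma seqE_hits b r (c : R) (Gs : seq (pred C)) :
  c <= 1 -> (forall j, (j < size Gs)%N -> c <= \sum_(x | nth xpred0 Gs j x) mu x) ->
  seqE (size Gs * b + r) (fun s => (~~ hits b Gs s)%:R) <= (size Gs)%:R * (1 - c) ^+ b.
Proof.
move=> c1; elim: Gs => [|G Gs IH] /= hG; first by rewrite seqE_const mul0r.
rewrite mulSn -addnA seqE_cat.
apply: le_trans (_ : seqE b (fun s => (~~ has G s)%:R + (size Gs)%:R * (1 - c) ^+ b) <= _).
  apply: seqE_le => s sz.
  apply: le_trans (_ : seqE (size Gs * b + r) (fun t => (~~ has G s)%:R + (~~ hits b Gs t)%:R) <= _).
    apply: seqE_le => t _; rewrite take_size_cat // drop_size_cat // negb_and -natrD ler_nat.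
    by case: (has G s); case: (hits b Gs t).
  rewrite seqE_add seqE_const lerD2l; apply: IH => j jGs; exact: (hG j.+1).
rewrite seqE_add seqE_const -(natr1 (size Gs)) mulrDl mul1r addrC lerD2l seqE_hasN //; exact: (hG 0).
Qed.

Lemma hitsP b Gs s x0 : hits b Gs s ->
  forall j, (j < size Gs)%N -> exists i, [/\ (j * b <= i < j.+1 * b)%N,
    (i < size s)%N & nth xpred0 Gs j (nth x0 s i)].
Proof.
elim: Gs s => [|G Gs IH] s //= /andP[/(has_nthP x0)[i szi Gi] hs] [|j] /= jGs.
  move: (szi); rewrite size_take_min leq_min => /andP[ib is_].
  by exists i; split; [rewrite mul1n ib | | move: Gi; rewrite nth_take].
have [k [kb ksz Gk]] := IH _ hs j jGs; exists (b + k)%N; split.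
- by rewrite !mulSn in kb *; lia.
- by move: ksz; rewrite size_drop; lia.
- by rewrite -nth_drop.
Qed.
End SeqExpectation.

Lemma big_tuple_cons (V : nmodType) (C : finType) m (F : m.+1.-tuple C -> V) :
  \sum_t F t = \sum_c \sum_(t : m.-tuple C) F [tuple of c :: t].
Proof.
rewrite (reindex (fun p : C * m.-tuple C => [tuple of p.1 :: p.2])) /=.
  by rewrite -(pair_bigA _ (fun c (t : m.-tuple C) => F [tuple of c :: t])).
exists (fun t : m.+1.-tuple C => (thead t, [tuple of behead t])) => [[c t] _|t _].
  by congr (_, _); apply: val_inj.
by rewrite [in RHS](tuple_eta t).
Qed.

Lemma seqE_tuple (R : realFieldType) (C : finType) (mu : C -> R) m (F : seq C -> R) :
  seqE mu m F = \sum_(t : m.-tuple C) (\prod_(c <- t) mu c) * F t.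
Proof.
elim: m F => [|m IH] F /=.
  rewrite (big_pred1 [tuple]) ?big_nil ?mul1r // => t.
  by apply/esym/eqP/val_inj; case: t => [[]].
rewrite big_tuple_cons; apply: eq_bigr => c _; rewrite IH mulr_sumr; apply: eq_bigr => t _.
by rewrite big_cons mulrA.
Qed.

(** The bridge from the product law on matrices to columns drawn in sequence. *)
Lemma seqE_matrix (R : realFieldType) (K : finNzRingType) n m
    (mu : 'cV[K]_n -> R) (F : seq 'cV[K]_n -> R) :
  \sum_(A : 'M[K]_(n, m)) (\prod_j mu (col j A)) * F [seq col j A | j <- enum 'I_m]
  = seqE mu m F.
Proof.
rewrite seqE_tuple.
pose h (t : m.-tuple 'cV[K]_n) := \matrix_(i, j) tnth t j i 0.
have col_h t j : col j (h t) = tnth t j by apply/colP => i; rewrite !mxE.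
rewrite (reindex h) /=.
  apply: eq_bigr => t _; rewrite -[X in _ = _ * F X]map_tnth_enum big_tuple.
  by congr (_ * F _); [apply: eq_bigr => j _ | apply: eq_map => j]; rewrite col_h.
exists (fun A => [tuple col j A | j < m]) => [t _|A _].
  by apply: eq_from_tnth => j; rewrite tnth_mktuple col_h.
by apply/matrixP => i j; rewrite mxE tnth_mktuple mxE.
Qed.

(** * Growth of the span of the drawn columns *)

Section SpanGrowth.
Variables (R : realFieldType) (F : finFieldType) (n : nat).
Let C : finType := 'cV[F]_n.
Variables (mu : C -> R) (K : pred C).
Hypotheses (mu_ge0 : forall c, 0 <= mu c) (mu_total : \sum_c mu c = 1).

Definition uncovered (U : {vspace 'cV[F]_n}) : R :=
  \sum_(c | K c && (c \notin U)) mu c.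

Lemma uncovered_le (U V : {vspace 'cV[F]_n}) :
  (U <= V)%VS -> uncovered V <= uncovered U.
Proof.
move=> UV; rewrite /uncovered [leLHS]big_mkcond [leRHS]big_mkcond /=.
apply: ler_sum => c _; case: (K c) => //=.
have [cU|_] := boolP (c \in U); first by rewrite (subvP UV _ cU).
by case: (c \notin V) => /=; rewrite ?lexx ?mu_ge0.
Qed.

(* As long as the span misses measure at least [delta], each column raises its
   dimension with probability at least [delta], so the expectation of
   [2 ^ - dim] on that event decays geometrically. *)
Lemma seqE_uncovered m (delta : R) (U : {vspace 'cV[F]_n}) :
  0 <= delta <= 1 ->
  2 ^+ \dim U *
    seqE mu m (fun s => (delta < uncovered (U + <<[seq x <- s | K x]>>))%R%:R)
  <= 2 ^+ n * (1 - delta / 2) ^+ m.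
Proof.
move=> /andP[d0 d1]; elim: m U => [|m IH] U.
  rewrite /= mulr1; apply: le_trans (_ : 2 ^+ \dim U * 1 <= _).
    by rewrite ler_wpM2l ?exprn_ge0 // lern1; case: (_ < _).
  rewrite mulr1 ler_eXn2l ?ltr1n //.
  by apply: leq_trans (dimvS (subvf U)) _; rewrite dimvf /dim /= muln1.
have dh : 0 <= 1 - delta / 2 by lra.
(* Enlarging the span only lowers the uncovered measure, so below [delta] the event has become
   impossible. *)
have [Ud|dU] := leP (uncovered U) delta.
  apply: le_trans (_ : 0 <= _); last by rewrite mulr_ge0 ?exprn_ge0.
  rewrite (_ : seqE _ _ _ = 0) ?mulr0 //; apply/le_anti/andP; split; last first.
    by apply: seqE_ge0 => // s; rewrite ler0n.
  rewrite -[leRHS](seqE_const mu_total m.+1); apply: seqE_le => // s _.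
  by rewrite ltNge (le_trans (uncovered_le (addvSl _ _)) Ud).
rewrite /= mulr_sumr.
set X := 2 ^+ n * (1 - delta / 2) ^+ m.
have X0 : 0 <= X by rewrite mulr_ge0 ?exprn_ge0.
(* A draw in [K] outside [U] raises the dimension, so the induction hypothesis, stated for
   [2 ^+ (dim + 1)], gains a factor 1/2; the other draws give [X]. The mean is
   [X * (1 - uncovered U / 2)]. *)
apply: le_trans (_ : \sum_c mu c * (X * (1 - (K c && (c \notin U))%:R / 2)) <= _).
  apply: ler_sum => c _; rewrite mulrCA ler_wpM2l //.
  have [Kc|nKc] := boolP (K c); last by rewrite /= mul0r subr0 mulr1; exact: IH.
  have [cU|cU] := boolP (c \in U).
    rewrite /= mul0r subr0 mulr1; apply: le_trans (IH U).
    rewrite ler_wpM2l ?exprn_ge0 //; apply: seqE_le => // s _.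
    rewrite span_cons addvA (_ : (U + <[c]>)%VS = U) //.
    by apply/addv_idPl; rewrite -memvE.
  rewrite /= mul1r; have := IH (U + <[c]>)%VS.
  have -> : \dim (U + <[c]>) = (\dim U).+1.
    rewrite dimv_disjoint_sum ?dim_vline.
      rewrite (_ : c != 0) ?addn1 //; by apply: contraNneq cU => ->; rewrite mem0v.
    apply/eqP; rewrite -subv0; apply/subvP => x; rewrite memv_cap => /andP[xU /vlineP[k xk]].
    have [k0|k0] := eqVneq k 0; first by rewrite xk k0 scale0r mem0v.
    by move: cU; rewrite -[c](scalerK k0) -xk memvZ.
  rewrite (_ : seqE _ _ (fun s => (_ < uncovered (U + << _ :: _ >>))%R%:R) =
     seqE mu m (fun s => (delta < uncovered (U + <[c]> + <<[seq x <- s | K x]>>))%R%:R)).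
    rewrite exprS -mulrA -/X => h; lra.
  by apply/le_anti/andP; split; apply: seqE_le => // s _; rewrite span_cons addvA.
rewrite (eq_bigr (fun c => X * (mu c - (if K c && (c \notin U) then mu c else 0) / 2))) => [|c _].
  rewrite -mulr_sumr sumrB mu_total -mulr_suml -big_mkcond -/(uncovered U).
  rewrite exprSr mulrA -/X ler_wpM2l //; lra.
by case: ifP => _ /=; field.
Qed.
End SpanGrowth.

(** * Columns of weight k as tuples of rows *)

Definition ucol n (i : 'I_n) : 'cV['F_2]_n := delta_mx i 0.

(** Repeated rows cancel in pairs, so the weight equals the length only for duplicate-free
    sequences. *)
Definition tvec n (s : seq 'I_n) : 'cV['F_2]_n := \sum_(i <- s) ucol i.

Lemma tvec_support n (s : seq 'I_n) :
  uniq s -> [set i | tvec s i 0 == 1] = [set i in s].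
Proof.
move=> us; apply/setP => i; rewrite !inE /tvec summxE.
rewrite (eq_bigr (fun j => (j == i)%:R)) => [|j _]; last by rewrite mxE eqxx andbT eq_sym.
have -> : (\sum_(j <- s) (j == i)%:R = (count_mem i s)%:R :> 'F_2).
  rewrite -sum1_count natr_sum [RHS]big_mkcond; apply: eq_bigr => j _.
  by rewrite /=; case: (j == i).
by rewrite count_uniq_mem //; case: (i \in s).
Qed.

Lemma ffact_le_expn n k : (n ^_ k <= n ^ k)%N.
Proof.
elim: k => [|k IH]; first by rewrite ffactn0.
by rewrite ffactnSr expnSr leq_mul ?leq_subr.
Qed.

(** The birthday bound: each of the [k] factors of [n ^_ k] falls short of [n] by less than [k]. *)
Lemma expn_leq_ffact n k : (n ^ k <= n ^_ k + k ^ 2 * n ^ k.-1)%N.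
Proof.
elim: k => [|k IH] //; rewrite ffactnSr expnS /=.
case: k IH => [|k] IH; first by rewrite /= ffactn0 expn0 subn0; lia.
rewrite /= in IH; have h : (n * n ^ k.+1 <= n * n ^_ k.+1 + k.+1 ^ 2 * n ^ k.+1)%N.
  apply: leq_trans (leq_mul (leqnn n) IH) _; by rewrite mulnDr leq_add2l mulnCA -expnS.
apply: (leq_trans h).
have f : (n ^_ k.+1 <= n ^ k.+1)%N.
  exact: ffact_le_expn.
nia.
Qed.

Lemma card_nonuniq n k :
  (\sum_(t : k.-tuple 'I_n) ~~ uniq t <= k ^ 2 * n ^ k.-1)%N.
Proof.
have := expn_leq_ffact n k.
have <- : #|{: k.-tuple 'I_n}| = (n ^ k)%N by rewrite card_tuple card_ord.
have <- : (\sum_(t : k.-tuple 'I_n) uniq t)%N = (n ^_ k)%N.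
  transitivity (#|'I_n| ^_ k)%N; last by rewrite card_ord.
  rewrite -card_uniq_tuples -sum1_card [RHS]big_mkcond.
  by apply: eq_bigr => t _; rewrite inE all_predT; case: uniq.
rewrite -sum1_card (eq_bigr (fun t : k.-tuple 'I_n => (uniq t + ~~ uniq t)%N)).
  2: by move=> t _; case: uniq.
by rewrite big_split leq_add2l.
Qed.

(** A column of weight [k] comes from [k!] duplicate-free tuples, and
    [k! * 'C(n, k) = n ^_ k <= n ^ k]. This one inequality carries upper bounds from columns to
    tuples and lower bounds from tuples to columns. *)
Lemma uniq_tuple_law (R : realType) n k (S : pred 'cV['F_2]_n) : (k <= n)%N ->
  (\sum_(t : k.-tuple 'I_n) (uniq t && S (tvec t)))%N%:R
    <= (n ^ k)%:R * \sum_(c | S c) column_law R k c.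
Proof.
move=> lekn.
have -> : (\sum_(t : k.-tuple 'I_n) (uniq t && S (tvec t)))%N =
   (\sum_(c | S c) \sum_(t : k.-tuple 'I_n) (uniq t && (tvec t == c)))%N.
  rewrite (exchange_big_dep predT) //=; apply: eq_bigr => t _.
  rewrite big_mkcond /= (bigD1 (tvec t)) //= eqxx andbT big1 ?addn0 => [|c /negPf ne].
    by case: (S _); case: uniq.
  by rewrite eq_sym ne andbF if_same.
rewrite natr_sum mulr_sumr; apply: ler_sum => c _; rewrite /column_law.
set A := [set i | _]; case: ifP => cA; last first.
  rewrite mulr0 big1 // => t _; case: (boolP (uniq t)) => //= ut.
  case: eqVneq => // tc; move: cA; rewrite /A -tc tvec_support // cardsE.
  by move: (ut) => /card_uniqP ->; rewrite size_tuple eqxx.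
have b0 : 0 < 'C(n, k)%:R :> R by rewrite ltr0n bin_gt0.
rewrite ler_pdivlMr // -natrM ler_nat.
apply: leq_trans (_ : k`! * 'C(n, k) <= _)%N; last first.
  by rewrite mulnC bin_ffact ffact_le_expn.
rewrite leq_mul2r; apply/orP; right.
have -> : (k`! = #|A| ^_ k)%N by rewrite (eqP cA) ffactnn.
rewrite -card_uniq_tuples -sum1_card [leqRHS]big_mkcond.
apply: leq_sum => t _; case: (boolP (uniq t)) => //= ut.
case: eqVneq => // tc; rewrite inE ut andbT.
rewrite (_ : all _ _) //; apply/allP => i it.
by change (i \in A); rewrite /A -tc tvec_support // inE.
Qed.

Lemma addcc_F2 n (x : 'cV['F_2]_n) : x + x = 0.
Proof. by rewrite -[x]scale1r -scalerDl (_ : 1 + 1 = 0) ?scale0r //; apply: val_inj. Qed.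

(** Once the other rows are fixed, the label of the first row is prescribed; hence the same [E] as
    for single rows. *)
Lemma tvec_fiber n k (P : finZmodType) (W : {additive 'cV['F_2]_n -> P}) (E : nat) :
  (forall v, n <= E * \sum_i (W (ucol i) == v))%N ->
  forall v, (n ^ k.+1 <= E * \sum_(t : k.+1.-tuple 'I_n) (W (tvec t) == v))%N.
Proof.
move=> hw v; rewrite big_tuple_cons exchange_big /= big_distrr /=.
rewrite -[X in (X ^ _)%N]card_ord expnSr -card_tuple -sum_nat_const.
apply: leq_sum => t _; rewrite card_ord.
apply: leq_trans (hw (v - W (tvec t))) _; rewrite leq_mul2l leq_sum ?orbT // => i _.
by rewrite [tvec (_ :: _)]big_cons raddfD eq_sym subr_eq eq_sym.
Qed.

(* [pi] stands for the quotient by the span of the contracted columns. Passing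
   from tuples of rows to columns costs the tuples with repeated rows, which are
   a fraction of at most [k ^ 2 / n]: hence [16] and [4] instead of the [8] and
   [2] of [approx_hom]. *)
Lemma quotient_section (R : realType) n k (P : finZmodType)
    (W : {additive 'cV['F_2]_n -> P})
    (pi : {additive 'cV['F_2]_n -> 'cV['F_2]_n}) (E : nat) :
  (forall v : P, v + v = 0) ->
  (forall v, n <= E * \sum_i (W (ucol i) == v))%N ->
  (0 < E)%N -> (16 * E ^ 4 * k.+3 ^ 2 <= n)%N -> (k.+3 <= n)%N ->
  \sum_(c | (W c == 0) && (pi c != 0)) column_law R k.+3 c <= (16 * E ^ 4)%:R^-1 ->
  exists2 rho : P -> 'cV['F_2]_n, {morph rho : u v / u + v} &
    forall v, (4 * E)%:R^-1 <=
      \sum_(c | (W c == v) && (pi c == rho v)) column_law R k.+3 c.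
Proof.
move=> P2 hw E0 nbig lekn hbad.
have n0 : (0 < n)%N by apply: leq_trans lekn.
(* Two rows and a remainder of length [k.+1], which must be nonempty for [tvec_fiber] to apply. *)
have sumT (S : pred 'cV['F_2]_n) : (\sum_(t : k.+3.-tuple 'I_n) S (tvec t))%N =
    (\sum_(a < n) \sum_(b < n) \sum_(t : k.+1.-tuple 'I_n)
       S (ucol a + ucol b + tvec t)%R)%N.
  rewrite big_tuple_cons; apply: eq_bigr => a _.
  rewrite big_tuple_cons; apply: eq_bigr => b _; apply: eq_bigr => t _.
  by rewrite {1}/tvec !big_cons addrA.
pose D : finType := k.+1.-tuple 'I_n.
have cD : #|D| = (n ^ k.+1)%N by rewrite card_tuple card_ord.
have nn : (n * n * n ^ k.+1 = n ^ k.+3)%N by rewrite (expnS _ k.+2) (expnS _ k.+1) mulnA.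
have := @approx_hom 'I_n D P 'cV['F_2]_n (fun i => pi (ucol i))
  (fun t => pi (tvec t)) (fun i => W (ucol i)) (fun t => W (tvec t)) E.
case=> //; rewrite ?card_ord ?cD //.
- exact: addcc_F2.
- by rewrite expn_gt0 n0.
- exact: tvec_fiber.
- pose S c := (W c == 0) && (pi c != 0).
  rewrite (_ : (\sum_a _)%N = (\sum_(t : k.+3.-tuple 'I_n) S (tvec t))%N); last first.
    rewrite sumT; apply: eq_bigr => a _; apply: eq_bigr => b _; apply: eq_bigr => t _.
    by rewrite /S !raddfD.
  rewrite nn.
  (* The allowance [1 / (8 * E ^ 4)] is split evenly between bad columns ([h1]) and repeated rows
     ([h2]). *)
  have h1 : (16 * E ^ 4 * \sum_(t : k.+3.-tuple 'I_n) (uniq t && S (tvec t)) <= n ^ k.+3)%N.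
    rewrite -(ler_nat R) natrM.
    have := uniq_tuple_law R S lekn; rewrite /S => h.
    apply: le_trans (ler_wpM2l (ler0n _ _) h) _.
    rewrite mulrCA ler_piMr ?ler0n // -[leRHS](divff (x := (16 * E ^ 4)%:R)).
      by rewrite ler_wpM2l ?ler0n.
    by rewrite pnatr_eq0 -lt0n muln_gt0 expn_gt0 E0.
  have h2 : (16 * E ^ 4 * \sum_(t : k.+3.-tuple 'I_n) ~~ uniq t <= n ^ k.+3)%N.
    apply: leq_trans (leq_mul (leqnn _) (card_nonuniq n k.+3)) _.
    by rewrite mulnA [leqRHS]expnS leq_mul.
  have h3 : (\sum_(t : k.+3.-tuple 'I_n) S (tvec t) <=
     \sum_(t : k.+3.-tuple 'I_n) (uniq t && S (tvec t)) + \sum_(t : k.+3.-tuple 'I_n) ~~ uniq t)%N.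
    by rewrite -big_split; apply: leq_sum => t _ /=; case: uniq; case: (S _).
  have h4 := leq_mul (leqnn (8 * E ^ 4)) h3; apply: (leq_trans h4).
  by move: h1 h2; rewrite mulnDr -!mulnA; lia.
move=> rho [rhoD hrho]; exists rho => // v.
pose S c := (W c == v) && (pi c == rho v).
have := hrho v; rewrite nn (_ : (\sum_a _)%N = (\sum_(t : k.+3.-tuple 'I_n) S (tvec t))%N); last first.
  rewrite sumT; apply: eq_bigr => a _; apply: eq_bigr => b _; apply: eq_bigr => t _.
  by rewrite /S !raddfD.
move=> h1.
have h2 : (4 * E * \sum_(t : k.+3.-tuple 'I_n) ~~ uniq t <= n ^ k.+3)%N.
  apply: leq_trans (leq_mul (leqnn _) (card_nonuniq n k.+3)) _.
  rewrite mulnA [leqRHS]expnS leq_mul //; apply: leq_trans nbig.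
  by rewrite leq_mul // leq_mul // -{1}[E]expn1 leq_pexp2l.
have h3 : (\sum_(t : k.+3.-tuple 'I_n) S (tvec t) <=
     \sum_(t : k.+3.-tuple 'I_n) (uniq t && S (tvec t)) + \sum_(t : k.+3.-tuple 'I_n) ~~ uniq t)%N.
  by rewrite -big_split; apply: leq_sum => t _ /=; case: uniq; case: (S _).
have h4 : (n ^ k.+3 <= 4 * E * \sum_(t : k.+3.-tuple 'I_n) (uniq t && S (tvec t)))%N.
  have h4 := leq_trans h1 (leq_mul (leqnn (2 * E)) h3).
  by move: h2 h4; rewrite mulnDr -!mulnA; lia.
have nk : 0 < (n ^ k.+3)%:R :> R by rewrite ltr0n expn_gt0 n0.
have E4 : 0 < (4 * E)%:R :> R by rewrite ltr0n muln_gt0.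
rewrite -(ler_pM2l nk); apply: le_trans (uniq_tuple_law R S lekn).
by rewrite ler_pdivrMr // mulrC -natrM ler_nat.
Qed.

(** Each of the [n %/ q] full periods contains the residue once; since [q <= n], the factor 2
    absorbs the incomplete period. *)
Lemma balanced_residues n q (r : nat) : (r < q)%N -> (q <= n)%N ->
  (n <= 2 * q * \sum_(i < n) (i %% q == r))%N.
Proof.
move=> rq qn.
have lt j : (j < n %/ q -> j * q + r < n)%N.
  move=> jn; apply: leq_trans (leq_trunc_div n q); rewrite -addnS.
  by apply: leq_trans (leq_mul jn (leqnn q)); rewrite mulSn addnC leq_add2r.
pose f (j : 'I_(n %/ q)) : 'I_n := Ordinal (lt j (ltn_ord j)).
have f_inj : injective f.
  move=> j1 j2 /(congr1 val) /= /addIn /eqP; rewrite eqn_pmul2r; last by apply: leq_ltn_trans rq.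
  by move/eqP/val_inj.
apply: (@leq_trans (2 * q * (n %/ q))%N).
  have := ltn_ceil n (leq_ltn_trans (leq0n r) rq).
  have : (0 < n %/ q)%N by rewrite divn_gt0 //; apply: leq_ltn_trans rq.
  move: (n %/ q)%N => x; nia.
rewrite leq_mul2l; apply/orP; right.
rewrite -[leqLHS]card_ord -(card_codom f_inj) -sum1_card [leqLHS]big_mkcond.
apply: leq_sum => i _; case: ifP => // /codomP[j ->].
by rewrite /f /= modnMDl modn_small ?eqxx.
Qed.

(** * The random matroid *)

From mathcomp Require Import boolp classical_sets.
From mathcomp Require Import topology normedtype sequences.
Import numFieldNormedType.Exports.
Local Open Scope classical_set_scope.

Lemma minor_isomorphic (S T U : finType) (M : matroid S) (N : matroid T)
    (K : matroid U) : isomorphic M N -> minor N K -> minor M K.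
Proof.
case=> f f_bij fP [K' red [g g_bij gP]]; exists K' => //.
exists (g \o f); first exact: bij_comp.
move=> A; rewrite fP; have := gP [set f x | x in A]%SET; rewrite -!imset_comp.
exact.
Qed.

(** The deterministic part: [s1] supplies the contracted columns and [s2] the representatives. By
    additivity of [rho], a relation of [B] makes the matching combination of representatives vanish
    under [pi], which places it in the contracted span. *)
Lemma hits_minor n m p q b (A : 'M['F_2]_(n, m)) (B : 'M['F_2]_(p, q))
    (W : {linear 'cV['F_2]_n -> 'cV['F_2]_p})
    (pi : {linear 'cV['F_2]_n -> 'cV['F_2]_n})
    (rho : 'cV['F_2]_p -> 'cV['F_2]_n) (s1 s2 : seq 'cV['F_2]_n) :
  {morph rho : u v / u + v} ->
  [seq col j A | j <- enum 'I_m] = s1 ++ s2 ->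
  (forall c, pi c = 0 -> c \in <<[seq c <- s1 | (W c == 0)%R]>>%VS) ->
  hits b [seq (fun c => (W c == col j B) && (pi c == rho (col j B))) | j <- enum 'I_q] s2 ->
  minor (column_matroid B) (column_matroid A).
Proof.
move=> rhoD sA piP hs.
have rho0 : rho 0 = 0 by apply: (addrI (rho 0)); rewrite -rhoD !addr0.
(* Over the field with two elements, additive maps are linear. *)
have rhoZ (d : 'F_2) v : rho (d *: v) = d *: rho v.
  have [->|->] : d = 0 \/ d = 1.
    by case: d => [[|[|?]] ?]; [left|right|]; rewrite //; apply: val_inj.
    by rewrite !scale0r.
  by rewrite !scale1r.
have sz : (size s1 + size s2 = m)%N by rewrite -size_cat -sA size_map size_enum_ord.
have nthA (i : 'I_m) : nth 0 (s1 ++ s2) i = col i A.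
  by rewrite -sA (nth_map i) ?size_enum_ord // nth_ord_enum.
have /fin_all_exists[y hy] (j : 'I_q) : exists i : 'I_m,
    [/\ (size s1 + j * b <= i < size s1 + j.+1 * b)%N, W (col i A) = col j B
      & pi (col i A) = rho (col j B)].
  have [|i [ib isz]] := hitsP 0 hs (j := j); first by rewrite size_map size_enum_ord.
  rewrite (nth_map j) ?size_enum_ord // nth_ord_enum => /andP[/eqP Wi /eqP pi_i].
  have im : (size s1 + i < m)%N by rewrite -sz ltn_add2l.
  have e : col (Ordinal im) A = nth 0 s2 i.
    by rewrite -nthA /= nth_cat ltnNge leq_addr /= addKn.
  by exists (Ordinal im); rewrite e; split=> //=; rewrite leq_add2l ltn_add2l.
pose X0 : {set 'I_m} := [set i : 'I_m | (i < size s1)%N && (W (col i A) == 0)]%SET.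
apply: (@column_minor _ _ _ _ _ A B W X0 y).
- move=> j1 j2 e; have [h1 _ _] := hy j1; have [h2 _ _] := hy j2; move: h1 h2.
  rewrite e => h1 h2; apply: val_inj; case: (ltngtP j1 j2) => // lt /=.
    have : (j1.+1 * b <= j2 * b)%N by rewrite leq_mul2r lt orbT.
    lia.
  have : (j2.+1 * b <= j1 * b)%N by rewrite leq_mul2r lt orbT.
  lia.
- move=> j; have [h _ _] := hy j; rewrite inE negb_and -leqNgt.
  by apply/orP; left; lia.
- by move=> i; rewrite inE => /andP[_ /eqP].
- by move=> j; have [] := hy j.
move=> d dB; apply: (subvP (_ : <<[seq c <- s1 | (W c == 0)%R]>> <= _)%VS).
  apply/span_subvP => c; rewrite mem_filter => /andP[Wc /(nthP 0)[i isz ic]].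
  have im : (i < m)%N by rewrite -sz ltn_addr.
  have colE' : col (Ordinal im) A = c by rewrite -nthA /= nth_cat isz.
  have jX0 : Ordinal im \in X0 by rewrite inE /= isz colE' Wc.
  by rewrite -colE'; apply: memv_span; exact: (fintype.image_f _ jX0).
apply: piP; rewrite linear_sum /=.
rewrite (eq_bigr (fun j => rho (d j *: col j B))) => [|j _].
  by rewrite -(big_morph rho rhoD rho0) dB.
by rewrite linearZ /= rhoZ; have [_ _ ->] := hy j.
Qed.

Lemma column_law_ge0 (R : realType) n k (c : 'cV['F_2]_n) : 0 <= column_law R k c.
Proof. by rewrite /column_law; case: ifP; rewrite // invr_ge0 ler0n. Qed.

Lemma matrix_law_ge0 (R : realType) n m k (A : 'M['F_2]_(n, m)) : 0 <= matrix_law R k A.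
Proof. by apply: prodr_ge0 => j _; apply: column_law_ge0. Qed.

Lemma matrix_prob_le (R : realType) n m k (P Q : 'M['F_2]_(n, m) -> Prop) :
  (forall A, P A -> Q A) -> matrix_prob R k P <= matrix_prob R k Q.
Proof.
move=> PQ; rewrite /matrix_prob [leLHS]big_mkcond [leRHS]big_mkcond /=.
apply: ler_sum => A _; case: asboolP => [/PQ QA|_]; first by rewrite asboolT.
by case: ifP => // _; apply: matrix_law_ge0.
Qed.

Lemma matrix_prob_le1 (R : realType) n m k (P : 'M['F_2]_(n, m) -> Prop) :
  (k <= n)%N -> matrix_prob R k P <= 1.
Proof. by move=> kn; rewrite -(matrix_law_total R m kn) matrix_prob_le. Qed.

(** [F] dominates the indicator of failure and sees only the list of columns. *)
Lemma matrix_prob_compl_le (R : realType) n m k (P : 'M['F_2]_(n, m) -> Prop)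
    (F : seq 'cV['F_2]_n -> R) :
  (k <= n)%N -> (forall A, 0 <= F [seq col j A | j <- enum 'I_m]) ->
  (forall A, ~ P A -> 1 <= F [seq col j A | j <- enum 'I_m]) ->
  1 - matrix_prob R k P <= seqE (column_law R k) m F.
Proof.
move=> kn F0 F1; rewrite -(matrix_law_total R m kn) /matrix_prob -seqE_matrix.
rewrite lerBlDr [leLHS]big_mkcond [X in _ + X]big_mkcond /= -big_split /=.
apply: ler_sum => A _; rewrite (asboolT I) -/(matrix_law R k A).
case: asboolP => PA; first by rewrite lerDr mulr_ge0 ?matrix_law_ge0.
by rewrite addr0 ler_peMr ?matrix_law_ge0 ?F1.
Qed.

(** Column [i] of [Wm], the image of the [i]-th unit vector, is the label of row [i]; the labels run
    cyclically through the [2 ^ p] vectors. *)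
Lemma balanced_matrix n p : (2 ^ p <= n)%N -> exists Wm : 'M['F_2]_(p, n),
  forall v, (n <= 2 * 2 ^ p * \sum_i (col i Wm == v))%N.
Proof.
set q := #|{: 'cV['F_2]_p}|.
have qE : q = (2 ^ p)%N by rewrite /q card_mx muln1 card_Fp.
rewrite -qE => qn; have q0 : (0 < q)%N by rewrite qE expn_gt0.
pose r i : 'I_q := Ordinal (ltn_pmod i q0).
exists (\matrix_(a, i) enum_val (r (val i)) a 0) => v.
apply: leq_trans (balanced_residues (ltn_ord (enum_rank v)) qn) _.
rewrite leq_mul2l; apply/orP; right; apply: leq_sum => i _.
have -> : col i (\matrix_(a, i) enum_val (r (val i)) a 0) = enum_val (r i).
  by apply/colP => a; rewrite !mxE.
case: eqP => // e; rewrite (_ : r i = enum_rank v) ?enum_rankK ?eqxx //.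
exact: val_inj.
Qed.

(** The first term bounds the failure of the first [m - q * b] columns to exhaust the kernel of [W]
    up to measure [delta], the second the failure of some block among the last [q * b] columns. *)
Lemma minor_failure (R : realType) n m k p q b (B : 'M['F_2]_(p, q))
    (E := (2 * 2 ^ p)%N) :
  (16 * E ^ 4 * k.+3 ^ 2 <= n)%N -> (q * b <= m)%N ->
  1 - matrix_prob R k.+3 (fun A : 'M['F_2]_(n, m) =>
        minor (column_matroid B) (column_matroid A))
  <= 2 ^+ n * (1 - (16 * E ^ 4)%:R^-1 / 2) ^+ (m - q * b) + q%:R * (1 - (4 * E)%:R^-1) ^+ b.
Proof.
move=> nbig qbm.
have E0 : (0 < E)%N by rewrite muln_gt0 expn_gt0.
have Ek : (E * k.+3 <= n)%N.
  apply: leq_trans nbig; apply: leq_mul; last by rewrite -{1}[k.+3]expn1 leq_pexp2l.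
  by apply: (@leq_trans (E ^ 4)%N); [rewrite -{1}[E]expn1 leq_pexp2l | rewrite leq_pmull].
have kn : (k.+3 <= n)%N by apply: leq_trans Ek; rewrite leq_pmull.
have pn : (2 ^ p <= n)%N.
  by apply: leq_trans Ek; apply: leq_trans (leq_pmulr _ _); rewrite // leq_pmull.
have [Wm hW] := balanced_matrix pn.
pose W : {linear 'cV['F_2]_n -> 'cV['F_2]_p} := mulmx Wm.
have mu0 (c : 'cV['F_2]_n) : 0 <= column_law R k.+3 c by apply: column_law_ge0.
have mu1 := column_law_total R kn.
set delta := (16 * E ^ 4)%:R^-1; set c0 := (4 * E)%:R^-1.
have inv1 (x : nat) : (0 < x)%N -> 0 <= (x%:R^-1 : R) <= 1.
  by move=> x0; rewrite invr_ge0 ler0n invf_le1 ?ltr0n // ler1n.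
have /andP[d0 d1] : 0 <= delta <= 1 by rewrite inv1 // muln_gt0 expn_gt0 E0.
have /andP[c00 c01] : 0 <= c0 <= 1 by rewrite inv1 // muln_gt0.
pose good (s : seq 'cV['F_2]_n) := `[< forall A : 'M['F_2]_(n, m),
  [seq col j A | j <- enum 'I_m] = s -> minor (column_matroid B) (column_matroid A) >].
pose F s : R := (~~ good s)%:R.
have F1 (A : 'M['F_2]_(n, m)) : ~ minor (column_matroid B) (column_matroid A) ->
    1 <= F [seq col j A | j <- enum 'I_m].
  by move=> nM; rewrite /F (_ : good _ = false) //; apply/asboolP => /(_ A erefl).
apply: (le_trans (matrix_prob_compl_le kn (fun A => ler0n R _) F1)).
have -> : seqE (column_law R k.+3) m F =
    seqE (column_law R k.+3) ((m - q * b) + (q * b + 0)) F.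
  by congr seqE; lia.
rewrite seqE_cat.
pose K : pred 'cV['F_2]_n := fun c => W c == 0.
apply: (@le_trans _ _ (seqE (column_law R k.+3) (m - q * b) (fun s1 =>
   (delta < uncovered (column_law R k.+3) K (0 + <<[seq c <- s1 | K c]>>))%R%:R
   + q%:R * (1 - c0) ^+ b))).
  apply: seqE_le => // s1 _.
  have fail0 : 0 <= q%:R * (1 - c0) ^+ b by rewrite mulr_ge0 ?exprn_ge0 ?subr_ge0.
  case: ltP => [_|hunc].
    rewrite -[leLHS]addr0 lerD //.
    rewrite -[leRHS](seqE_const mu1 (q * b + 0)).
    by apply: seqE_le => // s2 _; rewrite lern1 leq_b1.
  rewrite add0r.
  set U := <<[seq c <- s1 | K c]>>%VS in hunc *.
  (* A linear map with kernel exactly [U] models the quotient by [U] inside the same space. *)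
  pose pi := (\1 - projv U)%VF.
  have piE c : (pi c == 0) = (c \in U).
    rewrite /pi add_lfunE opp_lfunE id_lfunE subr_eq0.
    by apply/eqP/idP => [->|cU]; [exact: memv_proj | rewrite projv_id].
  have [||||||rho rhoD hrho] := @quotient_section R n k _ W pi E => //.
  - exact: addcc_F2.
  - by move=> v; rewrite /= (eq_bigr (fun i => (col i Wm == v) : nat)) // => i _; rewrite colE.
  - apply: le_trans hunc; rewrite le_eqVlt; apply/orP; left; apply/eqP.
    by rewrite /uncovered add0v; apply: eq_bigl => c; rewrite piE.
  pose Gs : seq (pred 'cV['F_2]_n) :=
    [seq (fun c => (W c == col j B) && (pi c == rho (col j B))) | j <- enum 'I_q].
  have szGs : size Gs = q by rewrite size_map size_enum_ord.
  have := @seqE_hits R _ (column_law R k.+3) mu0 mu1 b 0 c0 Gs c01; rewrite szGs => hh.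
  apply: le_trans (hh _); last first.
    move=> j jq; rewrite (nth_map (Ordinal jq)) ?size_enum_ord //; exact: hrho.
  apply: seqE_le => // s2 _; rewrite /F ler_nat.
  case: (boolP (hits _ _ _)) => [hs|_]; last by case: (good _).
  rewrite (_ : good _ = true) //; apply/asboolP => A sA.
  apply: (hits_minor rhoD sA _ hs) => c /eqP; by rewrite piE.
rewrite seqE_add seqE_const // lerD2r.
have := @seqE_uncovered R _ n _ K mu0 mu1 (m - q * b) delta 0.
by rewrite dimv0 expr0 mul1r; apply; rewrite d0.
Qed.

Lemma exists_expr_le (R : realType) (z e : R) : 0 <= z < 1 -> 0 < e ->
  exists l, z ^+ l <= e.
Proof.
move=> /andP[z0 z1] e0.
have /cvgrPdist_le/(_ _ e0) [N _ hN] : (GRing.exp z) @ \oo --> (0 : R).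
  by apply: cvg_expr; rewrite ger0_norm.
exists N; have := hN N (leqnn N); rewrite /= sub0r normrN ger0_norm //.
exact: exprn_ge0.
Qed.

Theorem theorem1 (R : realType) (T : finType) (M : matroid T) (hM : binary M) :
  exists (kM : nat) (LM : R),
    forall k : nat, (0 < k)%N -> (kM <= k)%N ->
    forall m : nat -> nat, (forall n : nat, LM * n%:R <= (m n)%:R) ->
      (fun n : nat =>
         @matrix_prob R n (m n) k (fun A => minor M (column_matroid A)))
        @ \oo --> (1 : R).
Proof.
have [p [q [B isoB]]] := hM.
pose E := (2 * 2 ^ p)%N.
have E0 : (0 < E)%N by rewrite muln_gt0 expn_gt0.
have inv1 (x : nat) : (0 < x)%N -> 0 < (x%:R^-1 : R) <= 1.
  by move=> x0; rewrite invr_gt0 ltr0n x0 invf_le1 ?ltr0n // ler1n.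
set delta : R := (16 * E ^ 4)%:R^-1; set c0 : R := (4 * E)%:R^-1.
have /andP[d0 d1] : 0 < delta <= 1 by rewrite inv1 // muln_gt0 expn_gt0 E0.
have /andP[c00 c01] : 0 < c0 <= 1 by rewrite inv1 // muln_gt0.
have z01 : 0 <= 1 - delta / 2 < 1 by apply/andP; split; lra.
(* The bound 1/4 leaves [2 ^- n] after the factor [2 ^+ n] of [minor_failure]. *)
have [l hl] : exists l, (1 - delta / 2) ^+ l <= 4^-1 by apply: exists_expr_le; rewrite ?invr_gt0.
(* Weight 3 is two rows plus a nonempty remainder. Of the columns, [q * n] form [q] blocks of length
   [n], and at least [l * n] remain for the contraction. *)
exists 3, (l + q)%:R => k _ k3 m hm.
have hmn n : ((l + q) * n <= m n)%N by rewrite -(ler_nat R) natrM.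
have -> : k = (k - 3).+3 by lia.
move: (k - 3)%N => {k3}k.
pose err n : R := 2^-1 ^+ n + q%:R * (1 - c0) ^+ n.
have cvg_err : (1 - err n) @[n --> \oo] --> (1 : R).
  have e : (1 : R) = 1 - (0 + q%:R * 0) by rewrite mulr0 addr0 subr0.
  rewrite [X in _ --> X]e.
  apply: cvgB; first exact: cvg_cst.
  apply: cvgD; first by apply: cvg_expr; rewrite ger0_norm; lra.
  apply: cvgMr; apply: cvg_expr; rewrite ger0_norm; lra.
apply: squeeze_cvgr cvg_err (cvg_cst _).
exists (16 * E ^ 4 * k.+3 ^ 2)%N => // n /= nbig.
have kn : (k.+3 <= n)%N.
  apply: leq_trans nbig; apply: leq_trans (_ : k.+3 ^ 2 <= _)%N.
    by rewrite -{1}[k.+3]expn1 leq_pexp2l.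
  by rewrite leq_pmull // muln_gt0 expn_gt0 E0.
rewrite matrix_prob_le1 // andbT.
have qm : (q * n <= m n)%N by apply: leq_trans (hmn n); rewrite mulnDl leq_addl.
have := @minor_failure R n (m n) k p q n B nbig qm; rewrite -/E -/delta -/c0.
rewrite !lerBlDr => h; apply: (le_trans h).
rewrite addrC lerD //.
  by apply: matrix_prob_le => A; apply: minor_isomorphic.
rewrite /err lerD2r exprVn -[leRHS]mul1r.
have two0 : 0 < 2 ^+ n :> R by rewrite exprn_gt0.
rewrite ler_pdivlMr // mulrAC -exprMn.
have /andP[z0 /ltW z1] := z01.
apply: le_trans (_ : (2 * 2) ^+ n * 4^-1 ^+ n <= _).
  rewrite ler_wpM2l ?exprn_ge0 ?mulr_ge0 //; apply: le_trans (_ : ((1 - delta / 2) ^+ l) ^+ n <= _).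
    by rewrite -exprM ler_wiXn2l // leq_subRL // -mulnDl addnC.
  by rewrite lerXn2r ?nnegrE ?exprn_ge0 // invr_ge0.
by rewrite -exprMn (_ : 2 * 2 * 4^-1 = 1) ?expr1n //; field.
Qed.
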